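(* Let $\mathcal F^{\mathrm{NE}}$ be a class of NE approximators and let $\mathcal F^{\mathrm{(C)CE}}$ be a class of CE approximators or of CCE approximators. Write $\mathcal O\mathcal F^{\mathrm{NE}}=\{\mathcal Of:f\in\mathcal F^{\mathrm{NE}}\}$, and similarly $\mathcal P\mathcal F^{\mathrm{NE}}$ and $\mathcal Q\mathcal F^{\mathrm{(C)CE}}$. Then for all $r>0$, $$\mathcal N_\infty(\mathcal O\mathcal F^{\mathrm{NE}},r)\le\mathcal N_\infty(\mathcal F^{\mathrm{NE}},r),\qquad \mathcal N_\infty(\mathcal P\mathcal F^{\mathrm{NE}},r)\le\mathcal N_\infty(\mathcal F^{\mathrm{NE}},r),\qquad \mathcal N_\infty(\mathcal Q\mathcal F^{\mathrm{(C)CE}},r)\le\mathcal N_\infty(\mathcal F^{\mathrm{(C)CE}},r).$$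
   Context: Fix a number of players $n\ge2$ and finite action sets $\mathcal A_i=\{1,\dots,m_i\}$, $i\in[n]$; $\mathcal A=\prod_i\mathcal A_i$. A payoff is $u=(u_i)_{i\in[n]}$ with $u_i:\mathcal A\to[0,1]$; $\mathcal U$ is the set of all payoffs. A joint strategy is $\pi\in\Delta\mathcal A$; a product strategy is $\sigma=(\sigma_i)_{i\in[n]}$ with $\sigma_i\in\Delta\mathcal A_i$. An NE approximator is a map $f:\mathcal U\to\prod_i\Delta\mathcal A_i$, with $f(u)_i$ player $i$'s strategy; a CE or CCE approximator is a map $f:\mathcal U\to\Delta\mathcal A$. Permutations: $\mathcal G_i$ is the group of all bijections $\rho_i:\mathcal A_i\to\mathcal A_i$. $\rho_iu$ is the payoff with $(\rho_iu)_j(a_i,a_{-i})=u_j(\rho_i^{-1}(a_i),a_{-i})$ for all $j$; $(\rho_i\pi)(a_i,a_{-i})=\pi(\rho_i^{-1}(a_i),a_{-i})$; $(\rho_i\sigma_i)(a_i)=\sigma_i(\rho_i^{-1}(a_i))$. Orbit averaging: for an NE approximator $f$, $(\mathcal O_if)(u)_i=f(u)_i$ and $(\mathcal O_if)(u)_j=\frac1{|\mathcal A_i|!}\sum_{\rho_i\in\mathcal G_i}f(\rho_iu)_j$ for $j\ne i$; $(\mathcal P_if)(u)_i=\frac1{|\mathcal A_i|!}\sum_{\rho_i\in\mathcal G_i}\rho_i^{-1}f(\rho_iu)_i$ and $(\mathcal P_if)(u)_j=f(u)_j$ for $j\ne i$. For a CE or CCE approximator $f$, $(\mathcal Q_if)(u)=\frac1{|\mathcal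 A_i|!}\sum_{\rho_i\in\mathcal G_i}\rho_i^{-1}f(\rho_iu)$. $\mathcal O=\mathcal O_1\circ\cdots\circ\mathcal O_n$, $\mathcal P=\mathcal P_1\circ\cdots\circ\mathcal P_n$, $\mathcal Q=\mathcal Q_1\circ\cdots\circ\mathcal Q_n$. Distances: $\|\sigma-\sigma'\|=\max_i\sum_{a_i}|\sigma_i(a_i)-\sigma_i'(a_i)|$ for product strategies, $\|\pi-\pi'\|=\sum_a|\pi(a)-\pi'(a)|$ for joint strategies; $\ell_\infty(f,g)=\sup_{u\in\mathcal U}\|f(u)-g(u)\|$. A class $\mathcal F_r$ of approximators of the same type (not required to be contained in $\mathcal F$) $r$-covers $\mathcal F$ if for every $f\in\mathcal F$ there is $f_r\in\mathcal F_r$ with $\ell_\infty(f,f_r)\le r$. $\mathcal N_\infty(\mathcal F,r)$ is the smallest cardinality of a class that $r$-covers $\mathcal F$ ($+\infty$ if no finite one exists). *)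

(* Defs.v *)
From HB Require Import structures.
From mathcomp Require Import all_boot all_order all_algebra all_fingroup.
From mathcomp Require Import all_classical all_reals all_analysis.

Set Implicit Arguments.
Unset Strict Implicit.
Unset Printing Implicit Defensive.

Import Order.TTheory GRing.Theory Num.Theory.

Local Open Scope classical_set_scope.
Local Open Scope ring_scope.

Record simplex (R : realType) (T : finType) := Simplex {
  simplex_val :> T -> R;
  simplex_ge0 : forall a, 0 <= simplex_val a;
  simplex_sum1 : \sum_a simplex_val a = 1 }.

Section Simplex.
Variables (R : realType) (T : finType).

Lemma simplex_pull_ge0 (h : T -> T) (p : simplex R T) (a : T) : 0 <= p (h a).
Proof. exact: simplex_ge0. Qed.

Lemma simplex_pull_sum1 (h : T -> T) (hI : injective h) (p : simplex R T) :
  \sum_a p (h a) = 1.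
Proof. by rewrite -(simplex_sum1 p) [RHS](reindex_inj hI). Qed.

Definition simplex_pull (h : T -> T) (hI : injective h) (p : simplex R T) :
  simplex R T :=
  @Simplex R T (fun a => p (h a)) (simplex_pull_ge0 h p) (simplex_pull_sum1 hI p).

Variables (k : nat) (p : 'S_k -> simplex R T).

Let avg (a : T) : R := (#|'I_k| `!)%:R^-1 * \sum_(rho : 'S_k) p rho a.

Lemma simplex_avg_ge0 (a : T) : 0 <= avg a.
Proof.
apply: mulr_ge0; first by rewrite invr_ge0 ler0n.
by apply: sumr_ge0 => rho _; exact: simplex_ge0.
Qed.

Lemma simplex_avg_sum1 : \sum_a avg a = 1.
Proof.
rewrite -mulr_sumr exchange_big /=.
under eq_bigr do rewrite simplex_sum1.
rewrite sumr_const card_ord card_Sn mulVf // pnatr_eq0 -lt0n fact_gt0.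
Qed.

Definition simplex_avg : simplex R T :=
  @Simplex R T avg simplex_avg_ge0 simplex_avg_sum1.

End Simplex.

Definition profile (n : nat) (m : 'I_n -> nat) : finType :=
  {dffun forall i : 'I_n, 'I_(m i)}.

Record payoff (R : realType) (n : nat) (m : 'I_n -> nat) := Payoff {
  payoff_val :> 'I_n -> profile m -> R;
  payoff_itv : forall i a, 0 <= payoff_val i a <= 1 }.

Definition product_strategy (R : realType) (n : nat) (m : 'I_n -> nat) :=
  forall i : 'I_n, simplex R 'I_(m i).

Definition joint_strategy (R : realType) (n : nat) (m : 'I_n -> nat) :=
  simplex R (profile m).

Definition ne_approximator (R : realType) (n : nat) (m : 'I_n -> nat) :=
  payoff R m -> product_strategy R m.

(* CE and CCE approximators are the same kind of map: they differ only in the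
   solution concept they are meant to approximate. *)
Definition cce_approximator (R : realType) (n : nat) (m : 'I_n -> nat) :=
  payoff R m -> joint_strategy R m.

Section Permutations.
Variables (R : realType) (n : nat) (m : 'I_n -> nat) (i : 'I_n).
Implicit Type rho : 'S_(m i).

(* a |-> (rho (a_i), a_{-i}) *)
Definition perm_profile rho (a : profile m) : profile m :=
  finfun (eqtype.dfwith a (rho (a i))).

Lemma perm_profile_inj rho : injective (perm_profile rho).
Proof.
move=> a b /ffunP ab; apply/ffunP => j; have := ab j; rewrite !ffunE.
have [->|ji] := eqVneq j i; first by rewrite !dfwith_in => /perm_inj.
by rewrite !dfwith_out // eq_sym.
Qed.

Lemma perm_payoff_itv rho (u : payoff R m) (j : 'I_n) (a : profile m) :
  0 <= u j (perm_profile rho^-1%g a) <= 1.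
Proof. exact: payoff_itv. Qed.

Definition perm_payoff rho (u : payoff R m) : payoff R m :=
  @Payoff R n m (fun j a => u j (perm_profile rho^-1%g a)) (perm_payoff_itv rho u).

Definition perm_strategy rho (s : simplex R 'I_(m i)) : simplex R 'I_(m i) :=
  simplex_pull (@perm_inj _ rho^-1%g) s.

Definition perm_joint rho (p : joint_strategy R m) : joint_strategy R m :=
  simplex_pull (@perm_profile_inj rho^-1%g) p.

End Permutations.

Section OrbitAveraging.
Variables (R : realType) (n : nat) (m : 'I_n -> nat).

Definition orbO_at (i : 'I_n) (f : ne_approximator R m) :
    ne_approximator R m :=
  fun u j => if j == i then f u j
             else simplex_avg (fun rho : 'S_(m i) => f (perm_payoff rho u) j).

Definition orbP_at (i : 'I_n) (f : ne_approximator R m) :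
    ne_approximator R m :=
  fun u => eqtype.dfwith (f u)
    (simplex_avg (fun rho : 'S_(m i) =>
       perm_strategy rho^-1%g (f (perm_payoff rho u) i))).

Definition orbQ_at (i : 'I_n) (f : cce_approximator R m) :
    cce_approximator R m :=
  fun u => simplex_avg (fun rho : 'S_(m i) =>
    perm_joint rho^-1%g (f (perm_payoff rho u))).

(* Compositions in increasing order of players, the last player's operator
   being applied first. *)
Definition orbO (f : ne_approximator R m) : ne_approximator R m :=
  foldr orbO_at f (enum 'I_n).

Definition orbP (f : ne_approximator R m) : ne_approximator R m :=
  foldr orbP_at f (enum 'I_n).

Definition orbQ (f : cce_approximator R m) : cce_approximator R m :=
  foldr orbQ_at f (enum 'I_n).

End OrbitAveraging.

Definition dist_product (R : realType) (n : nat) (m : 'I_n -> nat)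
    (s t : product_strategy R m) : R :=
  \big[Num.max/0]_(i < n) \sum_(a : 'I_(m i)) `|s i a - t i a|.

Definition dist_joint (R : realType) (n : nat) (m : 'I_n -> nat)
    (p q : joint_strategy R m) : R :=
  \sum_(a : profile m) `|p a - q a|.

Section Covering.
Variables (R : realType) (U S : Type) (dist : S -> S -> R).

Definition linf_dist (f g : U -> S) : \bar R :=
  ereal_sup [set (dist (f u) (g u))%:E | u in [set: U]].

Definition covers (r : R) (G F : set (U -> S)) : Prop :=
  forall f, F f -> exists2 g, G g & (linf_dist f g <= r%:E)%E.

(* Infimum of a set of natural numbers: it is attained when a finite cover
   exists, and is +oo otherwise. *)
Definition covering_number (F : set (U -> S)) (r : R) : \bar R :=
  ereal_inf [set (k%:R)%:E | k in
    [set k : nat | exists2 G : set (U -> S), (G #= `I_k)%card & covers r G F]].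

End Covering.

(* Main.v *)
Require Import Defs.
From HB Require Import structures.
From mathcomp Require Import all_boot all_order all_algebra all_fingroup.
From mathcomp Require Import all_classical all_reals all_analysis.

Set Implicit Arguments.
Unset Strict Implicit.
Unset Printing Implicit Defensive.

Import Order.TTheory GRing.Theory Num.Theory.

Local Open Scope classical_set_scope.
Local Open Scope ring_scope.

(* A map that is nonexpansive for the l_oo distance sends an r-cover of a class
   to an r-cover of its image, of no larger cardinality. Each orbit-averaging
   step is nonexpansive because the l_1 distance is convex and invariant under
   permutations of the coordinates, and u |-> rho u maps payoffs to payoffs. *)

(** The triangle inequality inside the average, followed by an exchange of the two sums, bounds the
    distance by the mean of [k!] distances, each at most [r]. *)
Lemma dist_simplex_avg_le (R : realType) (T : finType) (k : nat)
    (p q : 'S_k -> simplex R T) (r : R) :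
  (forall rho, \sum_a `|p rho a - q rho a| <= r) ->
  \sum_a `|simplex_avg p a - simplex_avg q a| <= r.
Proof.
move=> pq; set N : R := (#|'I_k| `!)%:R.
have N_gt0 : 0 < N by rewrite ltr0n fact_gt0.
have avgB a : `|simplex_avg p a - simplex_avg q a|
    <= N^-1 * \sum_(rho : 'S_k) `|p rho a - q rho a|.
  rewrite /= -mulrBr -sumrB normrM gtr0_norm ?invr_gt0//.
  by rewrite ler_pM2l ?invr_gt0// ler_norm_sum.
apply: (le_trans (ler_sum _ (fun a _ => avgB a))).
rewrite -mulr_sumr exchange_big /= mulrC ler_pdivrMr//.
apply: (le_trans (ler_sum _ (fun rho _ => pq rho))).
by rewrite sumr_const card_Sn -mulr_natr /N card_ord.
Qed.

(** Serves both for single-player strategies, where [h] permutes actions, and for joint strategies,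
    where [h] permutes profiles. *)
Lemma dist_simplex_pull (R : realType) (T : finType) (h : T -> T)
    (hI : injective h) (p q : simplex R T) :
  \sum_a `|simplex_pull hI p a - simplex_pull hI q a| = \sum_a `|p a - q a|.
Proof. by rewrite [RHS](reindex_inj hI). Qed.

(** The assumption [0 <= r] handles the initial value 0 of the maximum. *)
Lemma dist_product_leP (R : realType) (n : nat) (m : 'I_n -> nat)
    (s t : product_strategy R m) (r : R) : 0 <= r ->
  dist_product s t <= r <-> forall i, \sum_a `|s i a - t i a| <= r.
Proof.
move=> r0; split=> [/bigmax_leP[_ st] i|st]; first exact: st.
by apply/bigmax_leP; split=> // i _; exact: st.
Qed.

Section Nonexpansive.
Variables (R : realType) (U S : Type) (dist : S -> S -> R).
Implicit Types (r : R) (f g : U -> S) (F : set (U -> S)).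

(** The premise ranges over all payoffs because [T f u] may involve [f] at points other than [u].
    Having the same [r] on both sides makes the property stable under composition. *)
Definition nonexpansive r (T : (U -> S) -> U -> S) : Prop :=
  forall f g, (forall u, dist (f u) (g u) <= r) ->
  forall u, dist (T f u) (T g u) <= r.

Lemma nonexpansive_foldr r (I : Type) (T : I -> (U -> S) -> U -> S)
    (s : seq I) : (forall i, nonexpansive r (T i)) ->
  nonexpansive r (fun f => foldr T f s).
Proof. by move=> T_ne f g fg; elim: s => //= i s; exact: T_ne. Qed.

Lemma linf_dist_leP r f g :
  (linf_dist dist f g <= r%:E)%E <-> forall u, dist (f u) (g u) <= r.
Proof.
split=> [fg u|fg].
  rewrite -lee_fin; apply: le_trans fg.
  by apply: ereal_sup_ubound; exists u.
by apply: ge_ereal_sup => _ [u _ <-]; rewrite lee_fin.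
Qed.

Lemma covering_number_image_le r (T : (U -> S) -> U -> S) F :
  nonexpansive r T ->
  (covering_number dist (T @` F) r <= covering_number dist F r)%E.
Proof.
move=> T_ne; apply: le_ereal_inf_tmp => _ [k [G Gk GF] <-].
have TGk : (T @` G #<= `I_k)%card.
  by rewrite -(card_le_eqr Gk) card_image_le.
(* [T] may identify members of [G], while [covering_number] asks for the exact size of a cover;
   hence the passage to the true cardinality [k'] of the image. *)
have [k' TGk'] : finite_set (T @` G).
  by apply: finite_image; exists k.
have k'k : (k' <= k)%N.
  by rewrite -card_le_II -(card_le_eql TGk').
apply: (@le_trans _ _ (k'%:R)%:E); last by rewrite lee_fin ler_nat.
apply: ereal_inf_lbound; exists k' => //; exists (T @` G) => //.
move=> _ [f Ff <-]; have [g Gg /linf_dist_leP fg] := GF f Ff.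
by exists (T g); [exists g | apply/linf_dist_leP; exact: T_ne].
Qed.

End Nonexpansive.

Section OrbitAveraging.
Variables (R : realType) (n : nat) (m : 'I_n -> nat) (r : R).

Lemma orbO_at_nonexpansive (i : 'I_n) : 0 <= r ->
  nonexpansive (@dist_product R n m) r (@orbO_at R n m i).
Proof.
move=> r0 f g fg u; apply/dist_product_leP => // j; rewrite /orbO_at.
case: ifP => _; first by have /dist_product_leP := fg u; exact.
apply: dist_simplex_avg_le => rho.
by have /dist_product_leP := fg (perm_payoff rho u); exact.
Qed.

Lemma orbP_at_nonexpansive (i : 'I_n) : 0 <= r ->
  nonexpansive (@dist_product R n m) r (@orbP_at R n m i).
Proof.
move=> r0 f g fg u; apply/dist_product_leP => // j; rewrite /orbP_at.
have [->|ji] := eqVneq j i; last first.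
  rewrite !dfwith_out 1?eq_sym//.
  by have /dist_product_leP := fg u; exact.
rewrite !dfwith_in; apply: dist_simplex_avg_le => rho.
(* For each [rho], both strategies are relabelled by the same permutation, which therefore drops out
   of the distance. *)
rewrite dist_simplex_pull.
by have /dist_product_leP := fg (perm_payoff rho u); exact.
Qed.

Lemma orbQ_at_nonexpansive (i : 'I_n) :
  nonexpansive (@dist_joint R n m) r (@orbQ_at R n m i).
Proof.
move=> f g fg u; apply: dist_simplex_avg_le => rho.
by rewrite dist_simplex_pull; exact: fg.
Qed.

End OrbitAveraging.

Theorem theorem4p5 (R : realType) (n : nat) (hn : (2 <= n)%N) (m : 'I_n -> nat)
    (FNE : set (ne_approximator R m)) (FCCE : set (cce_approximator R m))
    (r : R) (hr : 0 < r) :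
  [/\ (covering_number (@dist_product R n m) ((@orbO R n m) @` FNE) r
         <= covering_number (@dist_product R n m) FNE r)%E,
      (covering_number (@dist_product R n m) ((@orbP R n m) @` FNE) r
         <= covering_number (@dist_product R n m) FNE r)%E
    & (covering_number (@dist_joint R n m) ((@orbQ R n m) @` FCCE) r
         <= covering_number (@dist_joint R n m) FCCE r)%E].
Proof.
have r0 := ltW hr.
split; apply: covering_number_image_le; apply: nonexpansive_foldr => i.
- exact: orbO_at_nonexpansive.
- exact: orbP_at_nonexpansive.
- exact: orbQ_at_nonexpansive.
Qed.
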